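(* Let $F$ be a free group of finite rank and let $R$ be a normal subgroup of $F$ generated as a normal subgroup by finitely many elements $r_1,\dots,r_n$. Let $\hat r_1,\dots,\hat r_n$ be a tuple Nielsen equivalent to $r_1,\dots,r_n$ such that, for some $0\le s\le n$ and some elements $x_1,\dots,x_s$ forming part of a free basis of $F$, $\hat r_i\equiv x_i^{\alpha_i}\bmod\gamma_2(F)$ with $\alpha_i$ a nonzero integer for $1\le i\le s$, and $\hat r_i\in\gamma_2(F)$ for $s<i\le n$. Let $W_1\cup W_2$ be a free basis of $R$ with $W_1=\{w_1,\dots,w_s\}$, $w_i\equiv y_i^{\delta_i}\bmod\gamma_2(F)$ for nonzero integers $\delta_i$ and elements $y_1,\dots,y_s$ forming part of a free basis of $F$, and $W_2=\{w_{s+1},w_{s+2},\dots\}\subseteq\gamma_2(F)$. Then there exist a tuple $r'_{s+1},\dots,r'_n$ Nielsen equivalent to $\hat r_{s+1},\dots,\hat r_n$, a set $\hat W_2=\{\hat w_{s+1},\hat w_{s+2},\dots\}$ equivalent to $W_2$, an integer $t$ with $s\le t\le n$, and nonzero integers $\beta_{s+1},\dots,\beta_t$, such that $r'_i\equiv\hat w_i^{\beta_i}\bmod R'$ for $s+1\le i\le t$ and $r'_i\in R'$ for $t+1\le i\le n$; and the (images of the) elements of $W=\{\hat w_i^{\beta_i}\mid s+1\le i\le t\}$ generate $\dfrac{R\cap F'}{[R,F]}$.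
   Context: $\gamma_2(F)=F'$ and $R'$ denote derived groups; $[R,F]$ is the subgroup generated by all commutators $[r,f]$ with $r\in R$, $f\in F$. Two finite tuples are Nielsen equivalent if one is obtained from the other by a finite sequence of elementary Nielsen transformations (permuting entries, inverting an entry, multiplying one entry by another). That $\hat W_2$ is equivalent to $W_2$ means that $\hat W_2$ is again a free basis of the subgroup freely generated by $W_2$. *)

(* Defs.v *)
From Stdlib Require Export Relation_Operators.
From HB Require Import structures.
From mathcomp Require Export all_boot ssralg ssrint.
From mathcomp Require Export boolp classical_sets functions cardinality.

Set Implicit Arguments.
Unset Strict Implicit.
Unset Printing Implicit Defensive.

Local Open Scope classical_set_scope.
Local Open Scope group_scope.

Section Groups.
Variable G : groupType.
Implicit Types (x y : G) (A B H K N : set G) (u v : seq G) (z : int).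

Definition expgz x z : G :=
  match z with Posz n => x ^+ n | Negz n => x ^- n.+1 end.

Definition subgroup H : Prop :=
  [/\ H 1, forall x y, H x -> H y -> H (x * y) & forall x, H x -> H x^-1].

Definition normal_subgroup H : Prop :=
  subgroup H /\ forall x y, H x -> H (x ^ y).

Definition generated A : set G := smallest subgroup A.

Definition normal_closure A : set G := smallest normal_subgroup A.

Definition commutator H K : set G :=
  generated [set [~ x, y] | x in H & y in K].

Definition derived H : set G := commutator H H.

Definition congr_mod N x y : Prop := N (x^-1 * y).

(* A subset B of a subgroup H is a free basis of H when B generates H and every
   map from B to a group extends to a homomorphism on H; the extension is
   unique because B generates H. Only the values of f on B and of phi on H
   matter. *)
Definition free_basis B H : Prop :=
  generated B = H /\
  forall (K : groupType) (f : G -> K), exists phi : G -> K,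
    (forall x y, H x -> H y -> phi (x * y) = phi x * phi y) /\
    (forall b, B b -> phi b = f b).

Definition part_of_free_basis (I : Type) (x : I -> G) H : Prop :=
  exists B, [/\ free_basis B H, injective x & range x `<=` B].

Inductive elementary_nielsen u : seq G -> Prop :=
| Nielsen_perm v of perm_eq u v : elementary_nielsen u v
| Nielsen_inv i of i < size u :
    elementary_nielsen u (set_nth 1 u i (nth 1 u i)^-1)
| Nielsen_mul i j of i < size u & j < size u & i != j :
    elementary_nielsen u (set_nth 1 u i (nth 1 u i * nth 1 u j)).

Definition nielsen_equiv : seq G -> seq G -> Prop :=
  clos_refl_trans (seq G) elementary_nielsen.

(* The elements of the quotient by N are represented by cosets, that is, by
   subsets of G, and its operations by those on subsets. *)
Definition coset N x : set G := [set x * y | y in N].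

Definition quotient_subgroup N (Q : set (set G)) : Prop :=
  [/\ Q N,
      forall A B, Q A -> Q B -> Q [set x * y | x in A & y in B]
    & forall A, Q A -> Q [set x^-1 | x in A]].

Definition images_generate A H N : Prop :=
  smallest (quotient_subgroup N) (coset N @` A) = coset N @` H.

End Groups.

Definition initial_segment (D : set nat) : Prop :=
  forall i j, i <= j -> D j -> D i.

(* Main.v *)
From mathcomp Require Import ssrnum zmodp perm matrix intdiv.
Require Import Defs.

Set Implicit Arguments.
Unset Strict Implicit.
Unset Printing Implicit Defensive.

Import GRing.Theory Num.Theory.

Local Open Scope classical_set_scope.
Local Open Scope group_scope.

(** Since [R'] lies in [[R, F]], both assertions concern abelian quotients
    of [R], and integer matrices decide them.

    Expand each [rhat_i], [i >= s], modulo [R'] as a product of powers of the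
    [w_k] (lemma [abelian_normal_form]). As [rhat_i] and the [w_k] with
    [k >= s] lie in [F'] while the [w_k] with [k < s] are nonzero powers of
    independent elements modulo [F'], only the [w_k] with [k >= s] occur
    (lemma [exponents_vanish]). The exponents form an integer matrix
    [C = L * diag(d) * Q] (Smith normal form), with [L] and [Q] invertible
    over the integers. Such a matrix is a product of elementary ones, and an
    elementary matrix is realized by a Nielsen move, so every invertible
    matrix acts on tuples of group elements up to Nielsen equivalence
    (lemma [nielsen_liftable_unitmx]). Let [L^-1] act on the tuple of the
    [rhat_i] and [Q] on finitely many of the [w_k]: the resulting [r'] and
    [what] have diagonal exponent matrix [d] (lemma [nielsen_diagonalize]),
    and [what], completed by the untouched [w_k], is still a free basis
    (lemma [nielsen_free_tuple]). The divisibility of the entries of [d] puts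
    the zero entries last, which yields [t].

    Congruences modulo [R'] are tested by additive maps: as [R] is free, an
    element of [R] lies in [R'] as soon as every additive map from [R] to the
    integers kills it (lemma [free_basis_derived]). This is why the effect of a
    Nielsen equivalence is recorded through its action on the values of such
    maps.

    For the generation, let [K] be generated by the [what_i^beta_i] and
    [[R, F]]. It contains all [r'_i], hence all [rhat_i] with [i >= s], so
    that [R] is generated by [K] and the [rhat_i] with [i < s]
    (lemma [normal_closure_generated]). In the normal form modulo [K] of an
    element of [R] lying in [F'], the exponents of these [rhat_i] vanish by
    [exponents_vanish] again; so the element lies in [K]. *)

(** * Subgroups, Nielsen equivalence and additive maps *)

Section Subgroups.
Variable G : groupType.
Implicit Types (A H N S : set G) (x y g : G) (u v : seq G).

Lemma subgroupJ S x y : subgroup S -> S x -> S y -> S (x ^ y).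
Proof.
by case=> _ SM SV Sx Sy; rewrite conjgE; apply: (SM); [exact: SV|exact: SM].
Qed.

Lemma subgroupR S x y : subgroup S -> S x -> S y -> S [~ x, y].
Proof.
move=> subS Sx Sy; have [_ SM SV] := subS.
by rewrite commgEl; apply: SM; [exact: SV|exact: subgroupJ].
Qed.

Lemma subgroupX S x n : subgroup S -> S x -> S (x ^+ n).
Proof.
case=> S1 SM _ Sx; elim: n => [|n IHn]; first by rewrite expg0.
by rewrite expgS; apply: SM.
Qed.

Lemma subgroupXz S x z : subgroup S -> S x -> S (expgz x z).
Proof.
move=> subS Sx; have [_ _ SV] := subS.
by case: z => n /=; [|apply: SV]; apply: subgroupX.
Qed.

Lemma subgroup_prod S I (r : seq I) (F : I -> G) :
  subgroup S -> (forall i, S (F i)) -> S (\prod_(i <- r) F i).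
Proof. by case=> S1 SM _ SF; apply: big_ind. Qed.

Lemma generated_subgroup A : subgroup (generated A).
Proof.
split=> [S [[S1 _ _] _] //|x y gx gy S [subS AS]|x gx S [subS AS]].
  by have [_ SM _] := subS; apply: SM; [apply: gx|apply: gy].
by have [_ _ SV] := subS; apply: SV; apply: gx.
Qed.

Lemma sub_generated A : A `<=` generated A.
Proof. exact: sub_gen_smallest. Qed.

Lemma generated_sub A S : subgroup S -> A `<=` S -> generated A `<=` S.
Proof. exact: smallest_sub. Qed.

Lemma normal_closure_normal A : normal_subgroup (normal_closure A).
Proof.
split=> [|x y nx S [nS AS]]; last by apply: (nS.2); apply: nx.
split=> [S [[[S1 _ _] _] _] //|x y gx gy S [nS AS]|x gx S [nS AS]].
  by have [[_ SM _] _] := nS; apply: SM; [apply: gx|apply: gy].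
by have [[_ _ SV] _] := nS; apply: SV; apply: gx.
Qed.

Lemma commutator_sub H1 H2 K1 K2 :
  H1 `<=` H2 -> K1 `<=` K2 -> commutator H1 K1 `<=` commutator H2 K2.
Proof.
move=> sH sK; apply: generated_sub; first exact: generated_subgroup.
move=> _ [x Hx [y Ky <-]]; apply: sub_generated.
by exists x; [exact: sH|exists y; [exact: sK|]].
Qed.

Lemma commutatorR H K x y : H x -> K y -> commutator H K [~ x, y].
Proof. by move=> Hx Ky; apply: sub_generated; exists x => //; exists y. Qed.

Lemma subgroupI S1 S2 : subgroup S1 -> subgroup S2 -> subgroup (S1 `&` S2).
Proof.
move=> [u1 M1 V1] [u2 M2 V2]; split=> // [x y [Sx Tx] [Sy Ty]|x [Sx Tx]].
  by split; [exact: M1|exact: M2].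
by split; [exact: V1|exact: V2].
Qed.

Lemma derived_sub H : subgroup H -> derived H `<=` H.
Proof.
move=> subH; apply: generated_sub => // _ [x Hx [y Hy <-]].
exact: subgroupR.
Qed.

Lemma commutatorT_sub H : normal_subgroup H -> commutator H setT `<=` H.
Proof.
move=> [subH nH]; have [_ HM HV] := subH.
apply: generated_sub => // _ [x Hx [y _ <-]].
by rewrite commgEl; apply: HM; [exact: HV|exact: nH].
Qed.

(** Conjugation by [y] multiplies an element [a] of [S] by [[~ a, y]]. *)
Lemma normal_over_commutator S H : subgroup S -> S `<=` H ->
  commutator H setT `<=` S -> normal_subgroup S.
Proof.
move=> subS SH HS; have [_ SM _] := subS; split=> // a y Sa.
rewrite -[a ^ y](mulVKg a) -commgEl; apply: SM => //.
by apply: HS; apply: commutatorR => //; exact: SH.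
Qed.

Lemma commutatorT_normal H : normal_subgroup H -> normal_subgroup (commutator H setT).
Proof.
move=> nH; apply: (normal_over_commutator (H := H)) => //.
  exact: generated_subgroup.
exact: commutatorT_sub.
Qed.

(** Quantifying over all [i] is harmless because the default value 1 lies in
    every subgroup; it makes the lemma insensitive to sizes. *)
Lemma nielsen_mem S u v : subgroup S -> nielsen_equiv u v ->
  (forall i, S (nth 1 u i)) <-> (forall i, S (nth 1 v i)).
Proof.
move=> subS; have [S1 SM SV] := subS.
have nthP w : (forall i, S (nth 1 w i)) <-> (forall x, x \in w -> S x).
  split=> [Sw x /(nthP 1)[i _ <-] //|Sw i].
  by case: (ltnP i (size w)) => [/(mem_nth 1)/Sw//|/(nth_default 1)->].
elim=> {u v} [u v|u|u v w _ IH1 _ IH2]; [|by []|by rewrite IH1].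
case=> {v} [v uv|i ltiu|i j ltiu ltju neij].
- by rewrite !nthP; split=> Sw x; [rewrite -(perm_mem uv)|rewrite (perm_mem uv)]; exact: Sw.
- split=> Su k; move: (Su k); rewrite nth_set_nth /=; case: eqP => // ->; first exact: SV.
  by move/SV; rewrite invgK.
- split=> Su k; move: (Su k); rewrite nth_set_nth /=; case: eqP => // ->.
    by move=> Si; apply: SM.
  move=> Sij; move: (Su j); rewrite nth_set_nth /= eq_sym (negbTE neij) => /SV Sj.
  by rewrite -[nth 1 u i](mulgK (nth 1 u j)); apply: SM.
Qed.

Lemma nielsen_size u v : nielsen_equiv u v -> size v = size u.
Proof.
elim=> {u v} [u v []|//|u v w _ <- _ //] => [w /perm_size//|i ltiu|i j ltiu _ _];
  by rewrite size_set_nth (maxn_idPr ltiu).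
Qed.

Lemma nielsen_trans u v w :
  nielsen_equiv u v -> nielsen_equiv v w -> nielsen_equiv u w.
Proof. exact: rt_trans. Qed.

Lemma nielsen_cons x u v : nielsen_equiv u v -> nielsen_equiv (x :: u) (x :: v).
Proof.
elim=> {u v} [u v|u|u v w _ IH1 _ IH2]; [|exact: rt_refl|exact: nielsen_trans IH2].
move=> uv; apply: rt_step; case: uv => {v} [v uv|i ltiu|i j ltiu ltju neij].
- by apply: Nielsen_perm; rewrite perm_cons.
- exact: (@Nielsen_inv _ (x :: u) i.+1).
- exact: (@Nielsen_mul _ (x :: u) i.+1 j.+1).
Qed.

Lemma nielsen_normal_closure u v : nielsen_equiv u v ->
  normal_closure [set` u] = normal_closure [set` v].
Proof.
move=> uv.
have sub (w1 w2 : seq G) : (forall i, normal_closure [set` w2] (nth 1 w1 i)) ->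
    normal_closure [set` w1] `<=` normal_closure [set` w2].
  move=> Sw; apply: (smallest_sub (normal_closure_normal [set` w2])).
  by move=> x /= /(nthP 1)[i _ <-].
have gen (w : seq G) i : normal_closure [set` w] (nth 1 w i).
  case: (ltnP i (size w)) => [/(mem_nth 1) wi|/(nth_default 1)->].
    exact: sub_gen_smallest.
  by have [[]] := normal_closure_normal [set` w].
have sg (w : seq G) := (normal_closure_normal [set` w]).1.
by apply/seteqP; split; apply: sub; [apply/(nielsen_mem (sg v) uv)|
  apply/(nielsen_mem (sg u) uv)] => i; exact: gen.
Qed.

(** The right-hand side is normal, since it lies between [[H, G]] and [H]. *)
Lemma normal_closure_generated u s K H : H = normal_closure [set` u] ->
  subgroup K -> commutator H setT `<=` K -> K `<=` H ->
  (forall i, s <= i -> K (nth 1 u i)) ->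
  H `<=` generated (nth 1 u @` `I_s `|` K).
Proof.
move=> defH subK HK KH Ku.
have subS := generated_subgroup (nth 1 u @` `I_s `|` K).
have SH : generated (nth 1 u @` `I_s `|` K) `<=` H.
  have [subH _] : normal_subgroup H by rewrite defH; exact: normal_closure_normal.
  have [H1 _ _] := subH.
  apply: generated_sub => // g [[i _ <-]|/KH//].
  case: (ltnP i (size u)) => [/(mem_nth 1) ui|/(nth_default 1)-> //].
  by rewrite defH; exact: sub_gen_smallest.
rewrite {1}defH; apply: smallest_sub.
  apply: (normal_over_commutator subS SH) => g /HK Kg.
  by apply: sub_generated; right.
move=> g /= /(nthP 1)[i _ <-]; apply: sub_generated.
by have [ltis|lesi] := ltnP i s; [left; exists i|right; exact: Ku].
Qed.

Definition additive_on H (f : G -> int) :=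
  forall x y, H x -> H y -> f (x * y) = (f x + f y)%R.

Section Additive.
Variables (H : set G) (f : G -> int).
Hypotheses (subH : subgroup H) (fD : additive_on H f).

Lemma additive_on1 : f 1 = 0%R.
Proof.
have [H1 _ _] := subH; apply: (@addrI _ (f 1)).
by rewrite -fD // mulg1 addr0.
Qed.

Lemma additive_onV x : H x -> f x^-1 = (- f x)%R.
Proof.
have [_ _ HV] := subH => Hx; apply: (@addrI _ (f x)).
by rewrite -fD ?mulgV ?subrr ?additive_on1 //; exact: HV.
Qed.

Lemma additive_onX x n : H x -> f (x ^+ n) = (f x * n%:Z)%R.
Proof.
move=> Hx; elim: n => [|n IHn]; first by rewrite expg0 additive_on1 mulr0.
rewrite expgS fD ?IHn //; last exact: subgroupX.
by rewrite intS mulrDr mulr1.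
Qed.

Lemma additive_onXz x z : H x -> f (expgz x z) = (f x * z)%R.
Proof.
move=> Hx; case: z => n /=; first exact: additive_onX.
by rewrite additive_onV ?additive_onX ?NegzE ?mulrN //; exact: subgroupX.
Qed.

Lemma additive_onJ x y : H x -> H y -> f (x ^ y) = f x.
Proof.
have [_ HM HV] := subH => Hx Hy.
rewrite conjgE !fD ?additive_onV //; [|exact: HV|exact: HM].
by rewrite addrC addrK.
Qed.

Lemma additive_on_derived g : derived H g -> f g = 0%R.
Proof.
have [H1 HM HV] := subH.
suff sub : derived H `<=` [set x | H x /\ f x = 0%R] by move=> /sub[].
apply: generated_sub.
  split=> /= [|x y [Hx fx] [Hy fy]|x [Hx fx]]; first by split; [|exact: additive_on1].
    by split; [exact: HM|rewrite fD // fx fy addr0].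
  by split; [exact: HV|rewrite additive_onV // fx oppr0].
move=> _ [x Hx [y Hy <-]] /=; split; first exact: subgroupR.
rewrite commgEl fD ?additive_onV ?additive_onJ //; [|exact: HV|exact: subgroupJ].
by rewrite addNr.
Qed.

Lemma additive_on_prod q (a : nat -> G) :
  (forall k, k < q -> H (a k)) -> f (\prod_(k < q) a k) = (\sum_(k < q) f (a k))%R.
Proof.
elim: q => [|q IHq] Ha; first by rewrite !big_ord0 additive_on1.
have Ha' k : k < q -> H (a k) by move=> ltkq; apply: Ha; exact: ltnW.
rewrite !big_ord_recr /= fD ?IHq //; last exact: Ha.
by apply: subgroup_prod => // k; apply: Ha'.
Qed.

End Additive.

Lemma free_basis_dual B H (b : G -> int) : free_basis B H ->
  exists2 f, additive_on H f & forall x, B x -> f x = b x.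
Proof.
by case=> _ /(_ (Algebra.to_multiplicative int) b)[phi [phiM phiB]]; exists phi.
Qed.

Lemma part_of_free_basis_dual (I : eqType) (x : I -> G) H (i : I) :
  part_of_free_basis x H ->
  exists2 f, additive_on H f & forall j, f (x j) = Posz (i == j).
Proof.
move=> [B [basisB x_inj xB]].
have [f fD fB] := free_basis_dual (fun z => Posz `[< z = x i >]) basisB.
exists f => // j; rewrite fB; last by apply: xB; exists j.
congr (Posz (nat_of_bool _)); apply/asboolP/eqP => [/x_inj//|->//].
Qed.

End Subgroups.

(** * Normal forms in abelian quotients *)

Lemma expgzD (G : groupType) (x : G) (z1 z2 : int) :
  expgz x (z1 + z2)%R = expgz x z1 * expgz x z2.
Proof.
have SV z : expgz x (z - 1)%R = expgz x z * x^-1.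
  case: z => [[|n]|n].
  - by rewrite sub0r /= expg0 mul1g.
  - by rewrite intS addrAC subrr add0r /= expgSr mulgK.
  - by rewrite NegzE -opprD addrC -intS -!NegzE /= -invgM -expgS.
have SD z : expgz x (z + 1)%R = expgz x z * x.
  by rewrite -{2}(addrK 1%R z) SV mulgVK.
elim: z2 => [|n IHn|n IHn]; first by rewrite addr0 /= mulg1.
  by rewrite intS (addrC 1%R) addrA !SD IHn mulgA.
by rewrite intS opprD (addrC (- 1)%R) addrA !SV IHn mulgA.
Qed.

Section AbelianQuotient.
Variables (G : groupType) (H N : set G).
Hypotheses (subH : subgroup H) (subN : subgroup N) (sNH : N `<=` H).
(* The quotient [H / N] is abelian. *)
Hypothesis commN : forall x y, H x -> H y -> N [~ x, y].
Implicit Types (x y g : G) (c : nat -> int) (q : nat).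
Local Notation "x =_N y" := (congr_mod N x y) (at level 70).

Lemma congr_refl x : x =_N x.
Proof. by have [N1 _ _] := subN; rewrite /congr_mod mulVg. Qed.

Lemma congr_sym x y : x =_N y -> y =_N x.
Proof. by have [_ _ NV] := subN; move/NV; rewrite invgM invgK. Qed.

Lemma congr_trans y x z : x =_N y -> y =_N z -> x =_N z.
Proof. by have [_ NM _] := subN; move=> xy /(NM _ _ xy); rewrite mulgA mulgK. Qed.

Lemma congrM x x' y y' : H y -> x =_N x' -> y =_N y' -> x * y =_N x' * y'.
Proof.
have [_ NM _] := subN; move=> Hy xx' yy'; rewrite /congr_mod.
have -> : (x * y)^-1 * (x' * y') =
    (x^-1 * x') * [~ x^-1 * x', y] * (y^-1 * y').
  by rewrite commgEl mulVKg conjgE invgM !mulgA mulgK.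
by apply: (NM) => //; apply: NM => //; apply: commN => //; exact: sNH.
Qed.

Lemma congrC x y : H x -> H y -> x * y =_N y * x.
Proof.
move=> Hx Hy; rewrite /congr_mod.
by have := commN Hy Hx; rewrite commgEl conjgE invgM !mulgA.
Qed.

Lemma congrV x y : H x -> x =_N y -> x^-1 =_N y^-1.
Proof.
have [_ NM NV] := subN; have [_ _ HV] := subH.
move=> Hx xy; rewrite /congr_mod invgK.
have -> : x * y^-1 = (x^-1 * y)^-1 * [~ (x^-1 * y)^-1, x^-1].
  by rewrite commgEl mulVKg conjgE invgM !invgK !mulgA mulgK.
by apply: (NM); [exact: NV|apply: commN; [apply/sNH/NV|exact: HV]].
Qed.

Variable a : nat -> G.

Definition monomial q c : G := \prod_(k < q) expgz (a k) (c k).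

Lemma monomialS q c : monomial q.+1 c = monomial q c * expgz (a q) (c q).
Proof. by rewrite /monomial big_ord_recr. Qed.

Lemma monomial0 q c : (forall k, k < q -> c k = 0%R) -> monomial q c = 1.
Proof. by move=> c0; rewrite /monomial big1 // => k _; rewrite c0 //= expg0. Qed.

Lemma monomial_widen q p c : q <= p -> (forall k, q <= k -> c k = 0%R) ->
  monomial p c = monomial q c.
Proof.
move=> leqp c0; elim: p leqp => [|p IHp]; first by rewrite leqn0 => /eqP->.
rewrite leq_eqVlt => /predU1P[->//|/[!ltnS] leqp].
by rewrite monomialS IHp // c0 //= expg0 mulg1.
Qed.

Lemma monomial_mem q c : (forall k, k < q -> H (a k)) -> H (monomial q c).
Proof. by move=> Ha; apply: subgroup_prod => // k; apply: subgroupXz => //; apply: Ha. Qed.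

Lemma monomialD q c d : (forall k, k < q -> H (a k)) ->
  monomial q (fun k => c k + d k)%R =_N monomial q c * monomial q d.
Proof.
have [_ HM _] := subH.
elim: q => [|q IHq] Ha.
  by rewrite /monomial !big_ord0 mulg1; exact: congr_refl.
have {}IHq := IHq (fun k ltkq => Ha k (ltnW ltkq)).
have Hm e : H (monomial q e) by apply: monomial_mem => k ltkq; apply: Ha; exact: ltnW.
have Hx e : H (expgz (a q) e) by apply: subgroupXz => //; apply: Ha.
rewrite !monomialS expgzD !mulgA.
apply: congrM; [exact: Hx| |exact: congr_refl].
apply: (@congr_trans (monomial q c * monomial q d * expgz (a q) (c q))).
  by apply: congrM; [exact: Hx| |exact: congr_refl].
rewrite -!mulgA; apply: congrM; [exact: HM|exact: congr_refl|exact: congrC].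
Qed.

(** The elements with such a normal form are a subgroup, since the congruence
    modulo [N] lets the factors commute. Requiring [D] to be an initial
    segment keeps the factors consecutive: two normal forms are multiplied
    after extending the shorter one by zero exponents. *)
Lemma abelian_normal_form (D : set nat) : initial_segment D ->
  (forall k, D k -> H (a k)) -> H `<=` generated (a @` D `|` N) ->
  forall g, H g -> exists q c,
    [/\ forall k, k < q -> D k, forall k, q <= k -> c k = 0%R & monomial q c =_N g].
Proof.
move=> D_init Ha genH g Hg.
have [H1 HM HV] := subH.
pose S := [set h | H h /\ exists q c, [/\ forall k, k < q -> D k,
  forall k, q <= k -> c k = 0%R & monomial q c =_N h]].
suff sub : generated (a @` D `|` N) `<=` S by have [] := sub _ (genH _ Hg).
have max_sub q p : (forall k, k < q -> D k) -> (forall k, k < p -> D k) ->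
    forall k, k < maxn q p -> D k.
  by move=> Dq Dp k; rewrite leq_max => /orP[/Dq|/Dp].
have mul x y : S x -> S y -> S (x * y).
  move=> [Hx [q [c [Dq c0 xc]]]] [Hy [p [d [Dp d0 yd]]]].
  have Dm := max_sub _ _ Dq Dp.
  split; first exact: HM.
  exists (maxn q p), (fun k => c k + d k)%R; split=> // [k|].
    by rewrite geq_max => /andP[/c0-> /d0->]; rewrite addr0.
  apply: congr_trans (monomialD _ _ _) _ => [k /Dm/Ha//|].
  rewrite (monomial_widen (leq_maxl q p) c0) (monomial_widen (leq_maxr q p) d0).
  by apply: congrM => //; apply: monomial_mem => k /Dp/Ha.
apply: generated_sub.
  split=> //.
    split=> //; exists 0, (fun=> 0%R); split=> //.
    by rewrite /monomial big_ord0; exact: congr_refl.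
  move=> x [Hx [q [c [Dq c0 xc]]]]; split; first exact: HV.
  have Ha' k : k < q -> H (a k) by move=> /Dq/Ha.
  exists q, (fun k => - c k)%R; split=> // [k /c0->|]; first by rewrite oppr0.
  apply: congr_trans (congrV _ xc); last exact: monomial_mem.
  have := monomialD c (fun k => - c k)%R Ha'.
  rewrite monomial0; last by move=> k _; rewrite subrr.
  move=> /congr_sym; rewrite /congr_mod mulg1 invgM => Nz.
  by rewrite /congr_mod.
move=> x [[k Dk <-]|Nx].
  split; first exact: Ha.
  exists k.+1, (fun l => Posz (l == k)); split=> [l|l|].
  - by rewrite ltnS => /D_init; apply.
  - by move=> ltkl; rewrite gtn_eqF.
  - rewrite monomialS monomial0 ?mul1g ?eqxx //=; first by rewrite expg1; exact: congr_refl.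
    by move=> l ltlk; rewrite ltn_eqF.
split; first exact: sNH.
exists 0, (fun=> 0%R); split=> //.
by rewrite /monomial big_ord0 /congr_mod invg1 mul1g.
Qed.

Lemma additive_on_monomial f q c g : additive_on H f -> (forall x, N x -> f x = 0%R) ->
  (forall k, k < q -> H (a k)) -> H g -> monomial q c =_N g ->
  f g = (\sum_(k < q) f (a k) * c k)%R.
Proof.
have [_ _ HV] := subH => fD fN Ha Hg /fN.
have Hm := monomial_mem c Ha.
rewrite (fD _ _ (HV _ Hm) Hg) (additive_onV subH fD Hm) => /eqP.
rewrite addrC subr_eq0 => /eqP->.
rewrite /monomial (additive_on_prod subH fD (a := fun k => expgz (a k) (c k))).
  by apply: eq_bigr => k _; rewrite (additive_onXz subH fD) //; exact: Ha.
by move=> k ltkq; apply: subgroupXz => //; exact: Ha.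
Qed.

End AbelianQuotient.

(** * Free bases under Nielsen equivalence *)

Section FreeTuples.
Variable G : groupType.
Implicit Types (u v : seq G) (B H : set G).

(** The images of the entries of [u] are prescribed by position, which forces
    the entries to be distinct and outside [B]. A free basis may be infinite;
    only its finite part [u] is subject to Nielsen moves. *)
Definition free_tuple_over u B H : Prop :=
  generated ([set` u] `|` B) = H /\
  forall (K : groupType) (l : nat -> K) (f : G -> K), exists phi : G -> K,
    [/\ forall x y, H x -> H y -> phi (x * y) = phi x * phi y,
        forall i, i < size u -> phi (nth 1 u i) = l i
      & forall b, B b -> phi b = f b].

Lemma free_tuple_overP u B H : free_tuple_over u B H <->
  [/\ uniq u, forall x, x \in u -> ~ B x & free_basis ([set` u] `|` B) H].
Proof.
split=> [[gen univ]|[uniq_u uB [gen univ]]].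
  split.
  (* Distinct positions are told apart by maps into the integers. *)
  - apply/(uniqPn 1) => -[i [j [ltij ltju eq_ij]]].
    have [phi [_ phiu _]] :=
      univ (Algebra.to_multiplicative int) (fun k => Posz (k == i)) (fun=> 1).
    have := phiu j ltju; rewrite -eq_ij phiu ?(ltn_trans ltij) // eqxx.
    by rewrite gtn_eqF.
  - move=> x /(nthP 1)[i ltiu <-] Bx.
    have [phi [_ phiu phiB]] :=
      univ (Algebra.to_multiplicative int) (fun k => Posz 1) (fun=> Posz 0).
    by have := phiB _ Bx; rewrite phiu.
  - split=> // K f; have [phi [phiM phiu phiB]] := univ K (fun i => f (nth 1 u i)) f.
    exists phi; split=> // b [/= /(nthP 1)[i ltiu <-]|]; [exact: phiu|exact: phiB].
split=> // K l f.
have [phi [phiM phiB]] := univ K (fun x => if x \in u then l (index x u) else f x).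
exists phi; split=> // [i ltiu|b Bb].
  have ui := mem_nth 1 ltiu.
  by rewrite phiB; [rewrite ui index_uniq|left].
by rewrite phiB; [case: ifP => // /uB|right].
Qed.

Lemma nielsen_generated u v B : nielsen_equiv u v ->
  generated ([set` u] `|` B) = generated ([set` v] `|` B).
Proof.
move=> uv.
have gen (w : seq G) i : generated ([set` w] `|` B) (nth 1 w i).
  case: (ltnP i (size w)) => [/(mem_nth 1) wi|/(nth_default 1)->].
    by apply: sub_generated; left.
  by have [] := generated_subgroup ([set` w] `|` B).
have sub (w1 w2 : seq G) : (forall i, generated ([set` w2] `|` B) (nth 1 w1 i)) ->
    generated ([set` w1] `|` B) `<=` generated ([set` w2] `|` B).
  move=> Sw; apply: generated_sub (generated_subgroup _) _ => x [/= /(nthP 1)[i _ <-]//|Bx].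
  by apply: sub_generated; right.
apply/seteqP; split; apply: sub.
  by apply/(nielsen_mem (generated_subgroup _) uv).
by apply/(nielsen_mem (generated_subgroup _) uv).
Qed.

(** A map prescribed on [v] determines, by undoing the move, the values to
    prescribe on [u]. *)
Lemma nielsen_free_tuple u v B H :
  nielsen_equiv u v -> free_tuple_over u B H -> free_tuple_over v B H.
Proof.
elim=> {u v} [u v|u|u v w _ IH1 _ IH2]; [|by []|by move/IH1/IH2].
move=> uv [genu univ]; have gen := nielsen_generated B (rt_step _ _ _ _ uv).
have subH : subgroup H by rewrite -genu; exact: generated_subgroup.
have [H1 HM HV] := subH.
have Hu i : H (nth 1 u i).
  case: (ltnP i (size u)) => [/(mem_nth 1) wi|/(nth_default 1)-> //].
  by rewrite -genu; apply: sub_generated; left.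
case: uv gen => {v} [v uv|i ltiu|i j ltiu ltju neij] gen.
- have /free_tuple_overP[uniq_u uB basis_u] : free_tuple_over u B H by [].
  apply/free_tuple_overP; split; first by rewrite -(perm_uniq uv).
    by move=> x; rewrite -(perm_mem uv); exact: uB.
  suff <- : [set` u] = [set` v] by [].
  by apply/seteqP; split=> x /=; rewrite (perm_mem uv).
- split=> [|K l f]; first by rewrite -gen.
  have [phi [phiM phiu phiB]] :=
    univ K (fun k => if k == i then (l k)^-1 else l k) f.
  have phi1 : phi 1 = 1 by apply: (@mulgI _ (phi 1)); rewrite -phiM // !mulg1.
  exists phi; split=> // k.
  rewrite size_set_nth (maxn_idPr ltiu) nth_set_nth /= => ltku.
  case: eqP => [->|/eqP neki]; last by rewrite phiu // (negbTE neki).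
  apply: (@mulgI _ (phi (nth 1 u i))).
  by rewrite -phiM ?mulgV ?phi1 ?phiu ?eqxx ?mulVg //; exact: HV.
- split=> [|K l f]; first by rewrite -gen.
  have [phi [phiM phiu phiB]] :=
    univ K (fun k => if k == i then l i * (l j)^-1 else l k) f.
  exists phi; split=> // k.
  rewrite size_set_nth (maxn_idPr ltiu) nth_set_nth /= => ltku.
  case: eqP => [->|/eqP neki]; last by rewrite phiu // (negbTE neki).
  by rewrite phiM // !phiu // eqxx eq_sym (negbTE neij) mulgVK.
Qed.

End FreeTuples.

(** * Integral matrices as Nielsen transformations *)

Section NielsenMatrices.
Local Open Scope ring_scope.
Variable G : groupType.

Definition values (f : G -> int) n (u : n.-tuple G) : 'cV[int]_n :=
  \col_i f (tnth u i).

(** The tuple [u'] may not depend on [H] and [f]: testing against all additive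
    maps at once says that [M] describes the passage from [u] to [u'] in the
    abelianization of any subgroup containing [u]. In this form products of
    matrices become compositions of Nielsen equivalences. *)
Definition nielsen_liftable n (M : 'M[int]_n) : Prop :=
  forall u : n.-tuple G, exists2 u' : n.-tuple G, nielsen_equiv u u' &
    forall (H : set G) f, subgroup H -> additive_on H f ->
      (forall i, H (tnth u i)) -> values f u' = M *m values f u.

Lemma nielsen_mem_tuple (H : set G) n (u v : n.-tuple G) : subgroup H ->
  nielsen_equiv u v -> (forall i, H (tnth u i)) -> forall i, H (tnth v i).
Proof.
move=> subH uv Hu i; rewrite (tnth_nth 1%g).
apply: ((nielsen_mem subH uv).1 _) => k.
case: (ltnP k n) => [ltkn|lenk].
  by rewrite -[k]/(val (Ordinal ltkn)) -(tnth_nth 1%g).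
by rewrite nth_default ?size_tuple //; case: subH.
Qed.

Lemma nielsen_liftable1 n : nielsen_liftable (1%:M : 'M_n).
Proof. by move=> u; exists u => [|H f *]; [exact: rt_refl|rewrite mul1mx]. Qed.

Lemma nielsen_liftableM n (M1 M2 : 'M_n) :
  nielsen_liftable M1 -> nielsen_liftable M2 -> nielsen_liftable (M1 *m M2).
Proof.
move=> lift1 lift2 u; have [u2 uu2 val2] := lift2 u; have [u1 u21 val1] := lift1 u2.
exists u1 => [|H f subH fD Hu]; first exact: nielsen_trans u21.
rewrite (val1 H) // ?(val2 H) ?mulmxA //.
exact: nielsen_mem_tuple uu2 Hu.
Qed.

Lemma liftable_of_seq n (M : 'M_n) (F : seq G -> seq G) :
  (forall u : n.-tuple G, nielsen_equiv u (F u)) ->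
  (forall (u : n.-tuple G) (H : set G) f, subgroup H -> additive_on H f ->
     (forall i, H (tnth u i)) -> \col_(i < n) f (nth 1%g (F u) i) = M *m values f u) ->
  nielsen_liftable M.
Proof.
move=> uF valF u.
have size_F : size (F u) == n by rewrite (nielsen_size (uF u)) size_tuple.
exists (Tuple size_F) => // H f subH fD Hu.
rewrite -(valF u H) //; apply/colP => i; rewrite !mxE (tnth_nth 1%g) //.
Qed.

Lemma nielsen_liftable_perm n (s : 'S_n) : nielsen_liftable (perm_mx s).
Proof.
move=> u; exists [tuple tnth u (s i) | i < n] => [|H f *].
  by apply: rt_step; apply: Nielsen_perm; rewrite perm_sym; apply/tuple_permP; exists s.
by apply/colP => i; rewrite -row_permE !mxE tnth_mktuple.
Qed.

(** For [i != j] this is a transvection; for [i = j] and [c = -2] it changes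
    the sign of the row [j], as inverting an entry does. *)
Definition shear n (i j : 'I_n) (c : int) : 'M[int]_n := 1%:M + c *: delta_mx i j.

Lemma mul_shear n p (i j k : 'I_n) c (A : 'M[int]_(n, p)) l :
  (shear i j c *m A) k l = A k l + c * (A j l *+ (k == i)).
Proof.
rewrite mulmxDl mul1mx -scalemxAl !mxE (bigD1 j) //= mxE eqxx andbT.
rewrite big1 => [|h nehj]; last by rewrite mxE (negbTE nehj) andbF mul0r.
by rewrite addr0; case: (k == i); rewrite ?mul1r ?mul0r.
Qed.

Lemma nielsen_liftable_inv n (j : 'I_n) : nielsen_liftable (shear j j (- 2%:Z)).
Proof.
apply: (@liftable_of_seq _ _ (fun u => set_nth 1%g u j (nth 1%g u j)^-1%g)).
  by move=> u; apply: rt_step; apply: Nielsen_inv; rewrite size_tuple.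
move=> u H f subH fD Hu; apply/colP => k.
rewrite mul_shear !mxE nth_set_nth /= -val_eqE /=.
case: eqP => [/val_inj->|_]; last by rewrite mulr0 addr0 (tnth_nth 1%g).
rewrite (additive_onV subH fD) -?tnth_nth //.
by rewrite mulr1n mulNr (_ : Posz 2 = 1 + 1) // mulrDl !mul1r opprD addrA subrr sub0r.
Qed.

Lemma nielsen_liftable_mul n (i j : 'I_n) : i != j -> nielsen_liftable (shear i j 1).
Proof.
move=> neij.
apply: (@liftable_of_seq _ _ (fun u => set_nth 1%g u i (nth 1 u i * nth 1 u j)%g)).
  by move=> u; apply: rt_step; apply: Nielsen_mul; rewrite ?size_tuple.
move=> u H f subH fD Hu; apply/colP => k.
rewrite mul_shear !mxE mul1r nth_set_nth /= -val_eqE /=.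
case: eqP => [/val_inj eq_ki|_]; last by rewrite addr0 (tnth_nth 1%g).
by rewrite -!tnth_nth fD // eq_ki.
Qed.

Lemma shearD n (i j : 'I_n) c d : i != j ->
  shear i j (c + d) = shear i j c *m shear i j d.
Proof.
move=> neij; rewrite /shear mulmxDr mulmx1 mulmxDl mul1mx.
rewrite -scalemxAl -scalemxAr mul_delta_mx_0 1?eq_sym // !scaler0 addr0.
by rewrite scalerDl addrA.
Qed.

(** A transvection with coefficient -1 is one with coefficient 1 conjugated by
    a sign change; the others are powers of these two. *)
Lemma nielsen_liftable_shear n (i j : 'I_n) c : i != j ->
  nielsen_liftable (shear i j c).
Proof.
move=> neij; have neji : (j == i) = false by rewrite eq_sym; apply/negbTE.
have lift_p := nielsen_liftable_mul neij.
have lift_n : nielsen_liftable (shear i j (- 1)).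
  suff -> : shear i j (- 1) = shear j j (- 2%:Z) *m (shear i j 1 *m shear j j (- 2%:Z)).
    have lift_inv := nielsen_liftable_inv j.
    by do 2!apply: nielsen_liftableM => //.
  rewrite /shear scale1r !mulmxDr !mulmx1 !mulmxDl !mul1mx -!scalemxAl -!scalemxAr.
  rewrite !(mulmxDr, mulmx1) -?scalemxAl -?scalemxAr.
  rewrite !(mul_delta_mx_cond, eqxx, neji, mulr1n, mulr0n).
  by apply/matrixP => k l; rewrite !mxE; case: (k == j); case: (k == i);
    case: (l == j); case: (k == l).
elim: c => [|n' IHn|n' IHn].
- by rewrite /shear scale0r addr0; exact: nielsen_liftable1.
- by rewrite intS shearD //; exact: nielsen_liftableM.
- by rewrite intS opprD shearD //; exact: nielsen_liftableM.
Qed.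

Lemma nielsen_liftable_lift0 n (M : 'M_n) : nielsen_liftable M ->
  nielsen_liftable (block_mx 1%:M 0 0 M : 'M_(1 + n)).
Proof.
move=> liftM u; case/tupleP: u => x u; have [u' uu' valu'] := liftM u.
have values_cons f y (v : n.-tuple G) :
    values f [tuple of y :: v] = col_mx (f y)%:M (values f v) :> 'cV_(1 + n).
  apply/colP => i; rewrite mxE; case: (split_ordP i) => k ->.
    by rewrite col_mxEu ord1 [RHS]mxE (tnth_nth 1%g).
  by rewrite col_mxEd [RHS]mxE !(tnth_nth 1%g).
exists [tuple of x :: u'] => [|H f subH fD Hu]; first exact: nielsen_cons.
rewrite !values_cons mul_block_col !mul0mx mul1mx addr0 add0r (valu' H) // => i.
by have := Hu (lift ord0 i); rewrite tnthS.
Qed.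

(** Such matrices multiply by adding the rows [b], so that it suffices to treat
    multiples of unit rows, which are transvections. *)
Lemma nielsen_liftable_ublock n (b : 'rV_n) :
  nielsen_liftable (block_mx 1%:M b 0 1%:M : 'M_(1 + n)).
Proof.
rewrite [b]row_sum_delta.
apply: (big_ind (fun b => nielsen_liftable (block_mx 1%:M b 0 1%:M : 'M_(1 + n)))).
- by rewrite -scalar_mx_block; exact: nielsen_liftable1.
- move=> b1 b2 l1 l2; have := nielsen_liftableM l2 l1.
  by rewrite mulmx_block !mulmx0 !mul1mx !mulmx1 !mul0mx !add0r !addr0.
- move=> j _.
  have ne0j : lshift n (0 : 'I_1) != rshift 1 j by [].
  suff -> : block_mx 1%:M (b 0 j *: delta_mx 0 j) 0 1%:M =
      shear (lshift n 0) (rshift 1 j) (b 0 j) :> 'M_(1 + n).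
    exact: nielsen_liftable_shear.
  apply/matrixP => k l.
  by case: (split_ordP k) => k' ->; case: (split_ordP l) => l' ->;
    rewrite ?(block_mxEul, block_mxEur, block_mxEdl, block_mxEdr) !mxE ?ord1
      ?(eq_lshift, eq_rshift, eq_lrshift, eq_rlshift) ?mulr0 ?addr0 ?add0r.
Qed.

Lemma nielsen_liftable_shear_mul n (M : 'M_n) (i j : 'I_n) c : i != j ->
  nielsen_liftable (shear i j c *m M) -> nielsen_liftable M.
Proof.
move=> neij /(nielsen_liftableM (nielsen_liftable_shear (- c) neij)).
by rewrite mulmxA -shearD // addNr /shear scale0r addr0 mul1mx.
Qed.

(** Expand the determinant along the first column. *)
Lemma unit_first_column n (M : 'M[int]_n.+1) : M \in unitmx ->
  (forall i, i != 0 -> M i 0 = 0) -> M 0 0 = 1 \/ M 0 0 = - 1.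
Proof.
rewrite unitmxE (expand_det_col _ ord0) (bigD1 ord0) //= => + M0.
rewrite big1 => [|i /M0->]; last by rewrite mul0r.
by rewrite addr0 unitrM unfold_in => /andP[/orP[/eqP->|/eqP->]]; [left|right].
Qed.

(** After a sign change [M] is an upper block matrix with corner 1, the product
    of a matrix of smaller size and of one clearing the first row. *)
Lemma nielsen_liftable_first_column n (M : 'M[int]_n.+1) :
  (forall M' : 'M[int]_n, M' \in unitmx -> nielsen_liftable M') ->
  M \in unitmx -> (forall i, i != 0 -> M i 0 = 0) -> nielsen_liftable M.
Proof.
move=> IHn.
have lift_1 (A : 'M[int]_n.+1) : A \in unitmx -> A 0 0 = 1 ->
    (forall i, i != 0 -> A i 0 = 0) -> nielsen_liftable A.
  move=> unitA A00 A0; pose A' : 'M_(1 + n) := A.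
  have defA : A' = block_mx 1%:M 0 0 (drsubmx A') *m block_mx 1%:M (ursubmx A') 0 1%:M.
    rewrite mulmx_block !mulmx0 !mul1mx !mulmx1 !mul0mx !add0r !addr0.
    rewrite -[LHS]submxK; congr block_mx.
      apply/matrixP => i j; rewrite !ord1 !mxE -[RHS]A00; congr (A _ _); exact: val_inj.
    apply/colP => i; rewrite !mxE -[RHS](A0 (rshift 1 i)) //; congr (A _ _); exact: val_inj.
  have unit_dr : drsubmx A' \in unitmx.
    have: A' \in unitmx by [].
    rewrite {1}defA unitmx_mul => /andP[+ _].
    by rewrite !unitmxE det_lblock det1 mul1r.
  rewrite -[A]/A' defA; apply: nielsen_liftableM.
    by apply: nielsen_liftable_lift0; exact: IHn.
  exact: nielsen_liftable_ublock.
move=> unitM M0; have [M00|M00] := unit_first_column unitM M0; first exact: lift_1.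
have inv0 : shear 0 0 (- 2%:Z) *m shear 0 0 (- 2%:Z) = 1%:M :> 'M_n.+1.
  rewrite {2}/shear mulmxDr mulmx1 -scalemxAr mulmxDl mul1mx -scalemxAl mul_delta_mx.
  by apply/matrixP => i j; rewrite !mxE; case: (i == 0); case: (j == 0); case: (i == j).
have -> : M = shear 0 0 (- 2%:Z) *m (shear 0 0 (- 2%:Z) *m M).
  by rewrite mulmxA inv0 mul1mx.
apply: nielsen_liftableM; first exact: nielsen_liftable_inv.
apply: lift_1.
- by rewrite unitmx_mul unitM andbT; have [] := mulmx1_unit inv0.
- by rewrite mul_shear M00.
- by move=> i nei0; rewrite mul_shear M0 // (negbTE nei0) mulr0.
Qed.

(** The general linear group over the integers is generated by elementary
    matrices: Euclidean division in the first column strictly decreases the sum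
    of its absolute values until a single nonzero entry remains. *)
Theorem nielsen_liftable_unitmx n (M : 'M_n) : M \in unitmx -> nielsen_liftable M.
Proof.
elim: n M => [|n IHn] M unitM.
  suff -> : M = 1%:M by exact: nielsen_liftable1.
  by apply/matrixP => -[].
have [k] := ubnP (\sum_i absz (M i 0%R))%N.
elim: k M unitM => // k IHk M unitM; rewrite ltnS => le_sum.
case: (pickP (fun ij : 'I_n.+1 * 'I_n.+1 => [&& ij.1 != ij.2, M ij.1 0 != 0,
    M ij.2 0 != 0 & (absz (M ij.2 0%R) <= absz (M ij.1 0%R))%N]))
  => [[i j] /= /and4P[]|none].
  move=> neij Mi Mj leji.
  apply: (nielsen_liftable_shear_mul neij (c := - divz (M i 0) (M j 0))); apply: IHk.
    rewrite unitmx_mul unitM andbT.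
    apply: (mulmx1_unit (B := shear i j (divz (M i 0) (M j 0))) _).1.
    by rewrite -shearD // addNr /shear scale0r addr0.
  apply: leq_trans le_sum; rewrite (bigD1 i) //= [ltnRHS](bigD1 i) //= -addSn.
  apply: leq_add.
    apply: leq_trans leji; rewrite mul_shear eqxx mulr1n mulNr -/(modz (M i 0) (M j 0)).
    (* The new entry is the remainder of the division by [M j 0]. *)
    by have := ltz_mod (M i 0) Mj; rewrite -ltz_nat gez0_abs ?modz_ge0.
  by apply: leq_sum => h nehi; rewrite mul_shear (negbTE nehi) mulr0 addr0.
have [i0 Mi0] : exists i, M i 0 != 0.
  apply/existsP; apply: contraT; rewrite negb_exists => /forallP /= M0.
  move: unitM; rewrite unitmxE (expand_det_col _ ord0) big1 ?unitr0 // => i _.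
  by rewrite (eqP (negbNE (M0 i))) mul0r.
have M0 i : i != i0 -> M i 0 = 0.
  move=> neii0; apply/eqP; apply: contraT => Mi.
  have [lei|/ltnW lei] := leqP (absz (M i 0)) (absz (M i0 0)).
    by have := none (i0, i); rewrite /= Mi Mi0 lei eq_sym neii0.
  by have := none (i, i0); rewrite /= Mi Mi0 lei neii0.
have defM : M = tperm_mx i0 0 *m (tperm_mx i0 0 *m M).
  by rewrite mulmxA -perm_mxM tperm2 perm_mx1 mul1mx.
rewrite defM; apply: nielsen_liftableM; first exact: nielsen_liftable_perm.
apply: nielsen_liftable_first_column => //.
  by rewrite unitmx_mul unitM unitmx_perm.
move=> i nei0; rewrite -xrowE mxE M0 // -(inj_eq (@perm_inj _ (tperm i0 0))).
by rewrite tpermK tpermL.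
Qed.

End NielsenMatrices.

(** * Diagonalizing a tuple against a basis *)

Section Diagonalization.
Local Open Scope ring_scope.
Variables (G : groupType) (H : set G).
Hypothesis subH : subgroup H.

(** Zero divides only zero. *)
Lemma sorted_dvdz_zeros (d : seq int) i : sorted dvdz d -> (find (pred1 0%R) d <= i)%N ->
  d`_i = 0.
Proof.
move=> sorted_d le_i; have [ltid|] := ltnP i (size d); last exact: nth_default.
have d0 : has (pred1 0) d by rewrite has_find (leq_ltn_trans le_i).
have tr : transitive dvdz by move=> x y z; exact: dvdz_trans.
have := sorted_leq_nth tr dvdzz 0 sorted_d (find (pred1 0) d) i.
rewrite (eqP (nth_find 0 d0)) !inE -has_find => /(_ d0 ltid le_i) /dvdzP[q ->].
exact: mulr0.
Qed.

(** If [C = L * d * Q] is the Smith normal form, then [L^-1] acting on [u] and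
    [Q] acting on [v] turn the relation [u = C * v] into [u' = d * v']. *)
Lemma nielsen_diagonalize a p (u : a.-tuple G) (v : p.-tuple G) (C : 'M[int]_(a, p)) :
  (forall i, H (tnth u i)) -> (forall k, H (tnth v k)) ->
  (forall f, additive_on H f -> values f u = C *m values f v) ->
  exists (u' : a.-tuple G) (v' : p.-tuple G) (t : nat) (d : nat -> int),
    [/\ nielsen_equiv u u' /\ nielsen_equiv v v', (t <= a)%N /\ (t <= p)%N,
        forall i, (i < t)%N -> d i <> 0,
        forall f i, additive_on H f -> (i < t)%N ->
          f (nth 1%g u' i) = f (nth 1%g v' i) * d i
      & forall f i, additive_on H f -> (t <= i < a)%N -> f (nth 1%g u' i) = 0].
Proof.
move=> Hu Hv valC.
have [L unitL [Q unitQ [d sorted_d defC]]] := int_Smith_normal_form C.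
have [u' uu' valu'] := @nielsen_liftable_unitmx G _ (invmx L) (etrans (unitmx_inv L) unitL) u.
have [v' vv' valv'] := nielsen_liftable_unitmx unitQ v.
have row f i : additive_on H f -> (i < a)%N ->
    f (nth 1%g u' i) = (if (i < p)%N then d`_i else 0) * f (nth 1%g v' i).
  move=> fD ltia.
  have : values f u' = (\matrix_(i, j) (d`_i *+ (i == j :> nat))) *m values f v'.
    by rewrite (valu' H) // valC // (valv' H) // defC !mulmxA mulVmx // mul1mx.
  move=> /colP/(_ (Ordinal ltia)); rewrite !mxE (tnth_nth 1%g) /= => ->.
  case: ifP => [ltip|/negbT]; last first.
    rewrite -leqNgt => lepi; rewrite mul0r big1 // => j _.
    by rewrite !mxE gtn_eqF ?mul0r //= (leq_trans _ lepi).
  rewrite (bigD1 (Ordinal ltip)) //= !mxE eqxx (tnth_nth 1%g) /= big1 ?addr0 //.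
  by move=> j neji; rewrite !mxE eq_sym (_ : (j == i :> nat) = false) ?mul0r //; apply/negbTE.
(* The diagonal of [C] may be shorter than [d], whence the minimum with [a]
   and [p]. *)
exists u', v', (minn (find (pred1 0) d) (minn a p)), (nth 0 d); split.
- by [].
- by rewrite !geq_min !leqnn !orbT.
- move=> i; rewrite leq_min => /andP[/(before_find 0) /= /eqP].
  by [].
- move=> f i fD; rewrite !leq_min => /and3P[_ ltia ltip].
  by rewrite row // ltip mulrC.
- move=> f i fD /andP[+ ltia]; rewrite row // !geq_min [(a <= i)%N]leqNgt ltia /=.
  by case: ltnP; rewrite ?mul0r ?orbF // => _ /(sorted_dvdz_zeros sorted_d)->; rewrite mul0r.
Qed.

End Diagonalization.

(** * Elements of the derived subgroup and generators of quotients *)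

Section FreeSubgroups.
Variable G : groupType.
Implicit Types (B H N V : set G) (D : set nat).

(** The exponents of the normal form of [g] modulo [H'] are the values at [g] of
    the maps dual to the basis. *)
Lemma free_basis_derived (w : nat -> G) D H g : initial_segment D -> set_inj D w ->
  free_basis (w @` D) H -> H g ->
  (forall f, additive_on H f -> f g = 0%R) -> derived H g.
Proof.
move=> D_init w_inj basisH Hg fg.
have genH := basisH.1.
have subH : subgroup H by rewrite -genH; exact: generated_subgroup.
have subN : subgroup (derived H) by exact: generated_subgroup.
have sNH := derived_sub subH.
have Hw k : D k -> H (w k) by move=> Dk; rewrite -genH; apply: sub_generated; exists k.
have commN : forall x y, H x -> H y -> derived H [~ x, y] by move=> *; exact: commutatorR.
have [|q [c [Dq _ mon_g]]] := abelian_normal_form subH subN sNH commN D_init Hw _ Hg.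
  rewrite -{1}genH; apply: generated_sub; first exact: generated_subgroup.
  by move=> x Bx; apply: sub_generated; left.
suff c0 k : k < q -> c k = 0%R.
  by move: mon_g; rewrite /congr_mod monomial0 // invg1 mul1g.
move=> ltkq.
have [f fD fw] := free_basis_dual (fun x => Posz `[< x = w k >]) basisH.
have := fg f fD.
rewrite (additive_on_monomial subH (N := derived H) fD _ _ Hg mon_g).
- rewrite (bigD1 (Ordinal ltkq)) //= fw; last by exists k => //; exact: Dq.
  rewrite asboolT // mul1r big1 ?addr0 // => j nejk.
  rewrite fw; last by exists j => //; exact: Dq.
  rewrite asboolF ?mul0r // => eq_w; case/negP: nejk; apply/eqP/val_inj.
  exact: (w_inj _ _ (mem_set (Dq j (ltn_ord j))) (mem_set (Dq k ltkq)) eq_w).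
- by move=> x; exact: additive_on_derived.
- by move=> l /Dq/Hw.
Qed.

Lemma free_basis_subset B B0 H : B0 `<=` B -> free_basis B H ->
  free_basis B0 (generated B0).
Proof.
move=> sB [genB univ]; split=> // K f; have [phi [phiM phiB]] := univ K f.
have sub : generated B0 `<=` H.
  by rewrite -genB; apply: generated_sub (generated_subgroup _) _ => x /sB/sub_generated.
by exists phi; split=> [x y /sub Hx /sub|b /sB]; [exact: phiM|exact: phiB].
Qed.

(** The union of the cosets in a subgroup of the quotient is a subgroup
    containing [N]. *)
Lemma images_generateP V H N : normal_subgroup N -> subgroup H -> V `<=` H ->
  H `<=` generated (V `|` N) -> images_generate V H N.
Proof.
move=> [subN nN] subH VH genH; have [N1 NM NV] := subN; have [H1 HM HV] := subH.
have coset_mem x y : coset N x y <-> N (x^-1 * y).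
  split=> [[z Nz <-]|Nxy]; first by rewrite mulKg.
  by exists (x^-1 * y); rewrite ?mulVKg.
have coset1 x : N x -> coset N x = N.
  move=> Nx; apply/seteqP; split=> y; rewrite coset_mem.
    by move=> /(NM _ _ Nx); rewrite mulVKg.
  by move=> Ny; apply: (NM) => //; exact: NV.
have cosetM x y : [set a * b | a in coset N x & b in coset N y] = coset N (x * y).
  apply/seteqP; split=> [_ [a /coset_mem Na [b /coset_mem Nb <-]]|z /coset_mem Nz].
    apply/coset_mem; rewrite (_ : _ * _ = (x^-1 * a) ^ y * (y^-1 * b)).
      by apply: (NM) => //; exact: nN.
    by rewrite conjgE invgM !mulgA mulgK.
  exists x; first by apply/coset_mem; rewrite mulVg.
  exists (x^-1 * z); last by rewrite mulVKg.
  by apply/coset_mem; move: Nz; rewrite invgM mulgA.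
have cosetV x : [set a^-1 | a in coset N x] = coset N x^-1.
  apply/seteqP; split=> [_ [a /coset_mem Na <-]|z /coset_mem].
    apply/coset_mem; rewrite invgK.
    have -> : x * a^-1 = (x^-1 * a)^-1 ^ x^-1 by rewrite conjgE !invgM !invgK !mulgA mulgK.
    by apply: nN; exact: NV.
  rewrite invgK => Nz; exists z^-1; last by rewrite invgK.
  apply/coset_mem.
  have -> : x^-1 * z^-1 = (x * z)^-1 ^ x by rewrite conjgE invgM !mulgA mulgVK.
  by apply: nN; exact: NV.
apply/seteqP; split.
  apply: smallest_sub; last by move=> _ [x Vx <-]; exists x => //; exact: VH.
  split.
  - by exists 1 => //; exact: coset1.
  - by move=> _ _ [x Hx <-] [y Hy <-]; rewrite cosetM; exists (x * y) => //; exact: HM.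
  - by move=> _ [x Hx <-]; rewrite cosetV; exists x^-1 => //; exact: HV.
move=> _ [g /genH gen_g <-] Q [[Q1 QM QV] VQ].
suff sub : generated (V `|` N) `<=` [set x | Q (coset N x)] by exact: sub.
apply: generated_sub => [|x [Vx|Nx]] /=; last by rewrite coset1.
  split=> /= [|x y Qx Qy|x Qx]; first by rewrite coset1.
    by rewrite -cosetM; exact: QM.
  by rewrite -cosetV; exact: QV.
by apply: VQ; exists x.
Qed.

End FreeSubgroups.

(** * Replacing finitely many elements of an indexed basis *)

Section Splice.
Variables (G : groupType) (s q : nat) (D : set nat) (w : nat -> G).
Hypothesis Dq : forall k, k < q -> D k.

Definition splice (v : seq G) (k : nat) : G := if k < q then nth 1 v (k - s) else w k.

Lemma splice_image v : size v = q - s ->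
  splice v @` (D `\` `I_s) = [set` v] `|` w @` (D `\` `I_q `\` `I_s).
Proof.
move=> size_v; apply/seteqP; split=> [_ [k [Dk /= /negP lesk] <-]|x].
  rewrite /splice; case: ifP => [ltkq|/negbT ltkq].
    by left; rewrite /= mem_nth // size_v ltn_sub2r // (leq_ltn_trans _ ltkq) // leqNgt.
  by right; exists k => //; do ?split => //=; apply/negP.
case=> [/= /(nthP 1)[i]|[k [[Dk /= nltkq] nltks] <-]].
  rewrite size_v => ltiq <-; have ltq : i + s < q by rewrite addnC -ltn_subRL.
  by exists (i + s); rewrite /splice ?ltq ?addnK //; split; [exact: Dq|rewrite /= ltnNge leq_addl].
by exists k => //; rewrite /splice; case: ifP.
Qed.

Lemma splice_inj v : size v = q - s -> uniq v ->
  (forall x, x \in v -> ~ (w @` (D `\` `I_q `\` `I_s)) x) -> set_inj D w ->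
  set_inj (D `\` `I_s) (splice v).
Proof.
move=> size_v uniq_v vB w_inj.
have lt k : ~ `I_s k -> k < q -> k - s < size v.
  by move=> /negP lesk ltkq; rewrite size_v ltn_sub2r // (leq_ltn_trans _ ltkq) // leqNgt.
move=> k l; rewrite !inE => -[Dk nk] [Dl nl]; rewrite /splice.
case: ifP => ltk; case: ifP => ltl.
- move/(uniqP 1 uniq_v); rewrite !inE => /(_ (lt k nk ltk) (lt l nl ltl)) eq_kl.
  move: nk nl => /negP + /negP; rewrite -!leqNgt => lek lel.
  by rewrite -(subnK lek) eq_kl subnK.
- move=> eq_kl; case: (vB (w l)).
    by rewrite -eq_kl mem_nth ?lt.
  by exists l => //; do 2?split => //; rewrite /= ltl.
- move=> eq_kl; case: (vB (w k)).
    by rewrite eq_kl mem_nth ?lt.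
  by exists k => //; do 2?split => //; rewrite /= ltk.
- by apply: w_inj; rewrite inE.
Qed.

End Splice.

(** * The theorem *)

Lemma additive_on_congr (F : groupType) (f : F -> int) g h : additive_on setT f ->
  congr_mod (derived setT) g h -> f g = f h.
Proof.
move=> fD; have subT : subgroup [set: F] by split.
move=> /(additive_on_derived subT fD); rewrite fD // (additive_onV subT fD) //.
by rewrite addrC => /subr0_eq.
Qed.

(** Apply to [g] the additive map dual to [y_k]: it kills the derived subgroup,
    hence [g] and every factor except the one with exponent [c k], to which it
    gives the value [delta_k * c k]. *)
Lemma exponents_vanish (F : groupType) s (y : 'I_s -> F) (delta : 'I_s -> int)
    (a : nat -> F) q (c : nat -> int) g :
  part_of_free_basis y setT -> (forall i, delta i <> 0%R) ->
  (forall i : 'I_s, congr_mod (derived setT) (a i) (expgz (y i) (delta i))) ->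
  (forall k, s <= k < q -> derived setT (a k)) -> derived setT g ->
  (forall f, additive_on setT f -> f g = (\sum_(k < q) f (a k) * c k)%R) ->
  forall k, k < q -> k < s -> c k = 0%R.
Proof.
move=> basisy delta_neq0 a_lo a_hi F'g val k ltkq ltks.
have subT : subgroup [set: F] by split.
have [f fD fy] := part_of_free_basis_dual (Ordinal ltks) basisy.
have := val f fD; rewrite (additive_on_derived subT fD) //.
rewrite (bigD1 (Ordinal ltkq)) //= (additive_on_congr fD (a_lo (Ordinal ltks))).
rewrite (additive_onXz subT fD) // fy eqxx mul1r big1 ?addr0 => [/esym/eqP|l nelk].
  by rewrite mulf_eq0 => /orP[/eqP/delta_neq0|/eqP].
have [ltls|lesl] := ltnP l s; last first.
  by rewrite (additive_on_derived subT fD) ?mul0r //; apply: a_hi; rewrite lesl /=.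
rewrite (additive_on_congr fD (a_lo (Ordinal ltls))) (additive_onXz subT fD) // fy.
rewrite -val_eqE /= eq_sym (_ : (l == k :> nat) = false) ?mul0r //.
exact/negbTE.
Qed.

Lemma image_segmentU (s : nat) (D : set nat) (T : Type) (w : nat -> T) : `I_s `<=` D ->
  w @` `I_s `|` w @` (D `\` `I_s) = w @` D.
Proof. by move=> sD; rewrite -image_setU setDUK. Qed.

Theorem theorem2p8
  (F : groupType) (X : set F) (finX : finite_set X) (basisX : free_basis X setT)
  (R : set F) (n : nat) (r : n.-tuple F)
  (nclR : R = normal_closure [set` r])
  (rhat : n.-tuple F) (r_rhat : nielsen_equiv r rhat)
  (s : nat) (le_sn : s <= n)
  (x : 'I_s -> F) (basisx : part_of_free_basis x setT)
  (alpha : 'I_s -> int) (alpha_neq0 : forall i, alpha i <> 0%Z)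
  (rhat_lo : forall i : 'I_s,
     congr_mod (derived setT) (nth 1 rhat i) (expgz (x i) (alpha i)))
  (rhat_hi : forall i, s <= i < n -> derived setT (nth 1 rhat i))
  (D : set nat) (D_init : initial_segment D) (le_sD : `I_s `<=` D)
  (w : nat -> F) (w_inj : set_inj D w)
  (basisR : free_basis (w @` `I_s `|` w @` (D `\` `I_s)) R)
  (y : 'I_s -> F) (basisy : part_of_free_basis y setT)
  (delta : 'I_s -> int) (delta_neq0 : forall i, delta i <> 0%Z)
  (w_lo : forall i : 'I_s,
     congr_mod (derived setT) (w i) (expgz (y i) (delta i)))
  (w_hi : w @` (D `\` `I_s) `<=` derived setT) :
  exists (r' : (n - s).-tuple F) (what : nat -> F) (t : nat) (beta : nat -> int),
    [/\ nielsen_equiv (drop s rhat) r',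
        set_inj (D `\` `I_s) what /\
        free_basis (what @` (D `\` `I_s)) (generated (w @` (D `\` `I_s))),
        s <= t <= n /\
        (forall i, s <= i < t ->
           [/\ D i, beta i <> 0%Z
             & congr_mod (derived R) (nth 1 r' (i - s))
                 (expgz (what i) (beta i))]),
        (forall i, t <= i < n -> derived R (nth 1 r' (i - s)))
      & images_generate [set expgz (what i) (beta i) | i in [set i | s <= i < t]]
          (R `&` derived setT) (commutator R setT)].
Proof.
have subT : subgroup [set: F] by split.
have normR : normal_subgroup R by rewrite nclR; exact: normal_closure_normal.
have subR := normR.1.
have [R1 RM RV] := subR.
have subF' : subgroup (derived [set: F]) by exact: generated_subgroup.
have subRF' := subgroupI subR subF'.
have subR' : subgroup (derived R) by exact: generated_subgroup.
have sR'R := derived_sub subR.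
have sR'RF : derived R `<=` commutator R setT by exact: commutator_sub.
have sRFR : commutator R setT `<=` R by exact: commutatorT_sub.
have sRFF' : commutator R setT `<=` derived setT by exact: commutator_sub.
have commR' : forall a b, R a -> R b -> derived R [~ a, b] by move=> *; exact: commutatorR.
have R_ncl : R = normal_closure [set` rhat] by rewrite nclR (nielsen_normal_closure r_rhat).
have Rrhat i : R (nth 1 rhat i).
  have [ltin|lein] := ltnP i n; last by rewrite nth_default ?size_tuple.
  by rewrite R_ncl; apply: sub_gen_smallest; rewrite /= mem_nth ?size_tuple.
rewrite image_segmentU // in basisR.
have genR := basisR.1.
have Rw k : D k -> R (w k) by move=> Dk; rewrite -genR; apply: sub_generated; exists k.
have addR f : additive_on setT f -> additive_on R f by move=> fD a b _ _; exact: fD.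
have addF'0 (f : F -> int) g : additive_on setT f -> derived setT g -> f g = 0%R.
  by move=> fD; exact: additive_on_derived.
have sub_genR : R `<=` generated (w @` D `|` derived R).
  rewrite -{1}genR; apply: generated_sub; first exact: generated_subgroup.
  by move=> g Bg; apply: sub_generated; left.
(* The exponents of [rhat_(s + i)] modulo [R'], given by their number and their
   values. *)
have coords (i : 'I_(n - s)) : exists qc : nat * (nat -> int),
    [/\ forall k, k < qc.1 -> D k, forall k, k < s -> qc.2 k = 0%R,
        forall k, qc.1 <= k -> qc.2 k = 0%R
      & forall f, additive_on R f ->
          f (nth 1 rhat (s + i)) = (\sum_(k < qc.1) f (w k) * qc.2 k)%R].
  have [q [c [Dq c0 mon_c]]] := abelian_normal_form subR subR' sR'R commR' D_init Rw
    sub_genR (Rrhat (s + i)).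
  have val f : additive_on R f ->
      f (nth 1 rhat (s + i)) = (\sum_(k < q) f (w k) * c k)%R.
    move=> fD; apply: (additive_on_monomial subR fD _ _ _ mon_c) => //.
      by move=> g; exact: additive_on_derived.
    by move=> k /Dq/Rw.
  exists (q, c); split=> //= k ltks.
  have [ltkq|/c0//] := ltnP k q.
  apply: (exponents_vanish basisy delta_neq0 w_lo (q := q) (g := nth 1 rhat (s + i))) => //.
  - by move=> l /andP[lesl /Dq Dl]; apply: w_hi; exists l => //; split=> //=; rewrite ltnNge lesl.
  - by apply: rhat_hi; rewrite leq_addr -ltn_subRL ltn_ord.
  - by move=> f /addR/val.
have {coords}[qc qcP] := choice coords.
(* A common number of exponents; it stays inside [D] because it is attained, or
   equal to [s]. *)
pose q := maxn s (\max_i (qc i).1).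
have le_sq : s <= q by exact: leq_maxl.
have Dq k : k < q -> D k.
  rewrite leq_max => /orP[|ltk]; first exact: le_sD.
  have [i ltki] : exists i, k < (qc i).1.
    apply/existsP; apply: contraLR ltk; rewrite negb_exists -leqNgt => /forallP lek.
    by apply/bigmax_leqP => i _; rewrite leqNgt.
  by have [+ _ _ _] := qcP i; exact.
pose u := [tuple of drop s rhat].
pose v := [tuple w (s + k) | k < q - s].
pose C := (\matrix_(i < n - s, k < q - s) (qc i).2 (s + k))%R.
have nth_u i : nth 1 u i = nth 1 rhat (s + i) by rewrite nth_drop.
have Dv (k : 'I_(q - s)) : D (s + k) by apply: Dq; rewrite -ltn_subRL.
have Ru i : R (tnth u i) by rewrite (tnth_nth 1) nth_u.
have Rv k : R (tnth v k) by rewrite tnth_mktuple; exact: Rw.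
have valC f : additive_on R f -> values f u = (C *m values f v)%R.
  move=> fD; apply/colP => i; rewrite !mxE (tnth_nth 1) nth_u.
  have [_ c_lo c_hi ->] := qcP i => //.
  have leq : (qc i).1 <= q by rewrite leq_max (leq_bigmax i) orbT.
  rewrite -(big_mkord xpredT (fun k => f (w k) * (qc i).2 k)%R).
  transitivity (\sum_(0 <= k < q) f (w k) * (qc i).2 k)%R.
    rewrite [RHS](big_cat_nat (leq0n _) leq) //= [X in (_ + X)%R]big1_seq ?addr0 // => k.
    by rewrite mem_index_iota => /andP[_ /andP[/c_hi-> _]]; rewrite mulr0.
  rewrite (big_cat_nat (leq0n _) le_sq) //= big1_seq ?add0r => [|k]; last first.
    by rewrite mem_index_iota => /andP[_ /c_lo->]; rewrite mulr0.
  rewrite -{1}[s]add0n big_addn big_mkord; apply: eq_bigr => k _.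
  by rewrite !mxE tnth_mktuple mulrC addnC.
have [r' [v' [t [d [[ur' vv'] [le_tns le_tqs] d_neq0 r'_lo r'_hi]]]]] :=
  nielsen_diagonalize subR Ru Rv valC.
(* Diagonalization changes only the basis elements of index between [s] and
   [q]. *)
pose H2 := generated (w @` (D `\` `I_s)).
pose B := w @` (D `\` `I_q `\` `I_s).
have splice_v : {in [pred k | s <= k], splice s q w v =1 w}.
  move=> k; rewrite inE /splice => lesk; case: ifP => // ltkq.
  have ltk : k - s < q - s by rewrite ltn_sub2r // (leq_ltn_trans lesk).
  by rewrite -[k - s]/(val (Ordinal ltk)) -tnth_nth tnth_mktuple /= subnKC.
have defW2 : [set` v] `|` B = w @` (D `\` `I_s).
  rewrite -(splice_image w Dq (v := v)) ?size_tuple //.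
  by apply: eq_imagel => k [_ /negP]; rewrite -leqNgt => lesk; exact: splice_v.
have free_v : free_tuple_over v B H2.
  apply/free_tuple_overP; split.
  - rewrite map_inj_in_uniq ?val_enum_ord ?enum_uniq // => k l _ _ eq_w.
    by apply/val_inj/(@addnI s); apply: (w_inj _ _ (mem_set (Dv k)) (mem_set (Dv l)) eq_w).
  - move=> g /mapP[k _ ->] [l [[Dl nlq] _] eq_w]; apply: nlq.
    by rewrite /= (w_inj _ _ (mem_set Dl) (mem_set (Dv k)) eq_w) -ltn_subRL.
  - rewrite defW2; apply: free_basis_subset basisR.
    by move=> _ [k [Dk _] <-]; exists k.
have /free_tuple_overP[uniq_v' v'B basis_v'] := nielsen_free_tuple vv' free_v.
pose what := splice s q w v'.
have imwhat : what @` (D `\` `I_s) = [set` v'] `|` B.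
  by apply: splice_image => //; rewrite size_tuple.
pose beta k := d (k - s).
have sH2 : H2 `<=` R `&` derived setT.
  apply: generated_sub => //.
  by move=> g Wg; split; [case: Wg => k [Dk _] <-; exact: Rw|exact: w_hi].
have whatH2 k : D k -> s <= k -> H2 (what k).
  move=> Dk lesk; rewrite -basis_v'.1 -imwhat; apply: sub_generated; exists k => //.
  by split=> //=; rewrite ltnNge lesk.
have Rr' : forall i, R (nth 1 r' i).
  apply/(nielsen_mem subR ur') => i; rewrite nth_u; exact: Rrhat.
have t_q i : i < s + t -> i < q.
  by move=> lti; apply: (leq_trans lti); rewrite -leq_subRL.
have r'_what i : s <= i < s + t ->
    congr_mod (derived R) (nth 1 r' (i - s)) (expgz (what i) (beta i)).
  move=> /andP[lesi ltit]; have ltis : i - s < t by rewrite ltn_subLR.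
  have [Rwhat _] := sH2 _ (whatH2 i (Dq i (t_q i ltit)) lesi).
  have Rwz := subgroupXz (beta i) subR Rwhat.
  apply: (free_basis_derived D_init w_inj basisR).
    by apply: RM => //; exact: RV.
  move=> f fD; rewrite fD ?(additive_onV subR fD) ?(additive_onXz subR fD) //; last exact: RV.
  rewrite (r'_lo f (i - s) fD ltis) /what /splice t_q // addNr //.
have r'_R' i : s + t <= i < n -> derived R (nth 1 r' (i - s)).
  move=> /andP[leti ltin]; apply: (free_basis_derived D_init w_inj basisR) => // f fD.
  have lesi : s <= i by apply: leq_trans leti; exact: leq_addr.
  by apply: r'_hi => //; rewrite leq_subRL // leti ltn_sub2r // (leq_ltn_trans lesi).
exists r', what, (s + t), beta; split=> //.
- split; last by rewrite imwhat.
  by apply: splice_inj => //; rewrite size_tuple.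
- rewrite leq_addr -leq_subRL //; split=> // i ltit; split; last exact: r'_what.
    by case/andP: ltit => _ /t_q/Dq.
  by case/andP: ltit => lesi ltit; apply: d_neq0; rewrite ltn_subLR.
set V := [set expgz _ _ | _ in _].
have sV : V `<=` R `&` derived setT.
  move=> _ [i /andP[lesi /t_q ltiq] <-].
  have [Rwi F'wi] := sH2 _ (whatH2 i (Dq i ltiq) lesi).
  by split; [exact: (subgroupXz _ subR Rwi)|exact: (subgroupXz _ subF' F'wi)].
(* Generation modulo [[R, F]] means that [R] and [F'] meet inside [K]. *)
pose K := generated (V `|` commutator R setT).
have subK : subgroup K by exact: generated_subgroup.
have sRFK : commutator R setT `<=` K by move=> g Ng; apply: sub_generated; right.
have sK : K `<=` R `&` derived setT.
  apply: generated_sub => //.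
  by move=> g [/sV//|Ng]; split; [exact: sRFR|exact: sRFF'].
have Kr' i : K (nth 1 r' i).
  have [K1 KM KV] := subK.
  have [ltin|lein] := ltnP i (n - s); last by rewrite nth_default ?size_tuple.
  rewrite -(addKn s i); have [ltit|leti] := ltnP (s + i) (s + t).
    have lesi : s <= s + i < s + t by rewrite leq_addr.
    have /sR'RF/sRFK Kc := r'_what _ lesi.
    have Kw : K (expgz (what (s + i)) (beta (s + i))).
      by apply: sub_generated; left; exists (s + i).
    by have := KM _ _ Kw (KV _ Kc); rewrite invgM invgK mulVKg.
  have := r'_R' (s + i); rewrite leti -ltn_subRL ltin => /(_ isT) R'r'.
  exact: sRFK (sR'RF _ R'r').
have Ku : forall i, K (nth 1 u i) by apply/(nielsen_mem subK ur').
have genK : R `<=` generated (nth 1 rhat @` `I_s `|` K).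
  apply: (normal_closure_generated R_ncl subK sRFK) => [g /sK[]//|i lesi].
  by rewrite -(subnKC lesi) -nth_u.
apply: images_generateP => //.
- exact: commutatorT_normal.
move=> g [Rg F'g].
have init_s : initial_segment `I_s by move=> i j /= leij; exact: leq_ltn_trans.
have commK a b : R a -> R b -> K [~ a, b] by move=> Ra _; apply: sRFK; exact: commutatorR.
have sKR : K `<=` R by move=> a /sK[].
have [q' [c [Dq' _ mon_g]]] := abelian_normal_form subR subK sKR commK init_s
  (fun k _ => Rrhat k) genK Rg.
suff c0 k : k < q' -> c k = 0%R.
  by move: mon_g; rewrite /congr_mod monomial0 // invg1 mul1g.
move=> ltkq; have ltks : k < s := Dq' k ltkq.
apply: (exponents_vanish basisx alpha_neq0 rhat_lo (q := q') (g := g)) => //.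
  by move=> l /andP[lesl /Dq']; rewrite /= ltnNge lesl.
move=> f fD; apply: (additive_on_monomial subR (addR f fD) _ _ Rg mon_g) => // z /sK[_ F'z].
exact: addF'0.
Qed.
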